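(* Let $T$ be a locally finite tree and let $S$ be a tree with $S\approx T$. If there exists an embedding $\phi\colon S\to T$ such that $T-\phi(S)$ has infinitely many connected components, then $m(T)$ is infinite.
   Context: An embedding is an injective graph homomorphism; for trees $S,T$ we write $S\approx T$ if $S$ embeds into $T$ and $T$ embeds into $S$. $T-\phi(S)$ denotes the graph obtained from $T$ by deleting the vertices of the image $\phi(S)$. The twin number $m(T)$ of a tree $T$ is the cardinality of the set of isomorphism classes of trees $T'$ with $T'\approx T$. A tree is locally finite if all vertex degrees are finite. *)

(* Defs.v *)
From mathcomp Require Import all_boot.
From mathcomp Require Import boolp classical_sets functions cardinality.
From Stdlib Require Import Relation_Operators.

Set Implicit Arguments.
Unset Strict Implicit.
Unset Printing Implicit Defensive.

Local Open Scope classical_set_scope.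

Record simple_graph : Type := SimpleGraph {
  vertex :> Type;
  adj : vertex -> vertex -> Prop;
  adj_sym : forall x y, adj x y -> adj y x;
  adj_irrefl : forall x, ~ adj x x
}.

Definition reachable (G : simple_graph) : G -> G -> Prop :=
  clos_refl_trans G (@adj G).

Definition component (G : simple_graph) (x : G) : set G :=
  [set y | reachable x y].

Definition components (G : simple_graph) : set (set G) := range (@component G).
Arguments components : clear implicits.

Definition connected_graph (G : simple_graph) : Prop :=
  inhabited G /\ forall x y : G, reachable x y.

(* [ordS i] is the cyclic successor of [i] in ['I_n]. *)
Definition is_cycle (G : simple_graph) (n : nat) (c : 'I_n -> G) : Prop :=
  [/\ 3 <= n, injective c & forall i : 'I_n, adj (c i) (c (ordS i))].

Definition acyclic (G : simple_graph) : Prop :=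
  forall (n : nat) (c : 'I_n -> G), ~ is_cycle c.

Definition is_tree (G : simple_graph) : Prop := connected_graph G /\ acyclic G.

Definition locally_finite (G : simple_graph) : Prop :=
  forall x : G, finite_set [set y | adj x y].

(* Embeddings need not reflect adjacency. *)
Definition embedding (G H : simple_graph) (f : G -> H) : Prop :=
  injective f /\ forall x y : G, adj x y -> adj (f x) (f y).

Definition embeds (G H : simple_graph) : Prop :=
  exists f : G -> H, embedding f.

Definition equimorphic (G H : simple_graph) : Prop := embeds G H /\ embeds H G.

Definition isomorphic (G H : simple_graph) : Prop :=
  exists2 f : G -> H, bijective f & forall x y : G, adj x y <-> adj (f x) (f y).

Section DeleteVertices.
Variables (G : simple_graph) (A : set G).

Let del_adj (x y : {v : G | ~ A v}) : Prop := adj (sval x) (sval y).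

Let del_adj_sym x y : del_adj x y -> del_adj y x.
Proof. exact: adj_sym. Qed.

Let del_adj_irrefl x : ~ del_adj x x.
Proof. exact: adj_irrefl. Qed.

Definition delete_vertices : simple_graph :=
  SimpleGraph del_adj_sym del_adj_irrefl.

End DeleteVertices.

Definition iso_class (G : simple_graph) : set simple_graph :=
  [set H | isomorphic G H].

(* The twin number m(T) is the cardinality of this set.  Any graph embedding
   into T has a copy on a subset of the vertices of T, so restricting graphs to
   the universe of T loses no isomorphism class. *)
Definition twin_classes (T : simple_graph) : set (set simple_graph) :=
  [set iso_class T' | T' in [set T' | is_tree T' /\ equimorphic T' T]].

(* Main.v *)
(* Let B be the boundary of phi(S) in T: the vertices outside phi(S) that have a
   neighbour in it.  B is infinite, and for every subset C of B the subgraph of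
   T induced on phi(S) and C is a twin of T.  Choose c_0, c_1, ... in B so
   rapidly going away from a root o in phi(S) that a ball in T around o reaching
   c_{i+1} is larger than one reaching c_i inside phi(S) + c_i.  Then the sizes
   of the balls around o in the twin S_I given by {c_i | i in I} determine I.
   An isomorphism from S_I to a fixed representative of its class carries o to
   one of countably many vertices, and this vertex determines the ball sizes.
   Hence countably many classes would make the set of all I countable. *)
Require Import Defs.
From mathcomp Require Import all_boot.
From mathcomp Require Import boolp classical_sets functions cardinality.
From mathcomp Require Import finmap.
From Stdlib Require Import Relation_Operators Operators_Properties.

Local Open Scope classical_set_scope.

(** * Finite sets and Cantor's theorem *)

Lemma finite_subset_card_eq (T : Type) (A B : set T) :
  finite_set B -> A `<=` B -> (A #= B)%card -> A = B.
Proof.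
move=> finB AB cAB; have finA := sub_finite_set AB finB.
apply: (@fset_set_inj {classic T}) => //; apply/eqP.
rewrite eqEfcard (@fcard_eq {classic T} {classic T} A B finA finB cAB) leqnn andbT.
by rewrite -(@fset_set_sub {classic T}).
Qed.

(** Cantor's diagonal argument: [D] consists of the codes of sets that miss their own code, and its
    own code can be neither in [D] nor outside it. *)
Lemma not_injective_set_nat (F : set nat -> nat) : ~ injective F.
Proof.
move=> F_inj; pose D := [set n | exists2 A, F A = n & ~ A n].
have nD : ~ D (F D) by move=> DF; case: (DF) => A /F_inj -> /(_ DF).
by apply: (nD); exists D.
Qed.

(** * Induced subgraphs and balls *)

(** A vertex carries a proof of [~ ~ A x]; [vin] and [vin_prop] translate from and to [A x]. *)
Definition induced (G : simple_graph) (A : set G) : simple_graph :=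
  delete_vertices (~` A).

Definition vin {G : simple_graph} {A : set G} (x : G) (Ax : A x) : induced G A :=
  exist _ x (fun nAx => nAx Ax).

Lemma vin_prop (G : simple_graph) (A : set G) (x : induced G A) : A (sval x).
Proof. exact: contrapT (proj2_sig x). Qed.

Lemma sval_inj (U : Type) (P : U -> Prop) : injective (@sval U P).
Proof. by move=> [x px] [y py] /= xy; exact: eq_exist. Qed.

(* The vertices joined to [o] by a walk of length at most [n] whose vertices
   after [o] lie in [A]. *)
Fixpoint ball (G : simple_graph) (A : set G) (o : G) (n : nat) : set G :=
  if n is m.+1 then
    ball G A o m `|` [set z | A z /\ exists2 y, ball G A o m y & adj y z]
  else [set o].

(** A walk of length at most [n] from [o] stays in the ambient ball of radius [n], so beyond that
    radius [A] has no influence. *)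
Lemma ball_local (G : simple_graph) (A B : set G) (o : G) (n : nat) :
  A `&` ball G setT o n `<=` B -> ball G A o n `<=` ball G B o n.
Proof.
have ballT m : ball G A o m `<=` ball G setT o m.
  elim: m => [//|m IH] z /= [/IH|[_ [y /IH hy yz]]]; first by left.
  by right; split => //; exists y.
elim: n => [|n IH] AB //=.
have {}IH : ball G A o n `<=` ball G B o n.
  by apply: IH => z [Az bz]; apply: AB; split => //; left.
move=> z [/IH|[Az [y hy yz]]]; first by left.
right; split; last by exists y => //; exact: IH.
by apply: AB; split => //; right; split => //; exists y => //; exact: ballT.
Qed.

Lemma ball_mono (G : simple_graph) (A B : set G) (o : G) (n : nat) :
  A `<=` B -> ball G A o n `<=` ball G B o n.
Proof. by move=> AB; apply: ball_local => z []/AB. Qed.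

Lemma ball_leq (G : simple_graph) (A : set G) (o : G) (m n : nat) :
  m <= n -> ball G A o m `<=` ball G A o n.
Proof.
move=> /subnK <-; elim: (n - m) => // k IH z /IH; rewrite addSn /=.
by left.
Qed.

Lemma ball_sub (G : simple_graph) (A : set G) (o : G) (n : nat) :
  A o -> ball G A o n `<=` A.
Proof. by move=> Ao; elim: n => [|n IH] z /=; [move=> -> | move=> [/IH|[]]]. Qed.

Lemma finite_ball (G : simple_graph) (A : set G) (o : G) (n : nat) :
  locally_finite G -> finite_set (ball G A o n).
Proof.
move=> lf; elim: n => [|n IH] /=; first exact: finite_set1.
rewrite finite_setU; split => //.
apply: (@sub_finite_set _ _ (\bigcup_(y in ball G A o n) [set z | adj y z])).
  by move=> z [_ [y hy yz]]; exists y.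
by apply: bigcup_finite => // y _; exact: lf.
Qed.

(** * Reachability and embeddings *)

Lemma reachable_ball (G : simple_graph) (x y : G) :
  reachable x y -> exists n, ball G setT x n y.
Proof.
move=> /clos_rt_rtn1_iff; elim => [|u v uv _ [n hu]].
  by exists 0.
by exists n.+1; right; split => //; exists u.
Qed.

Lemma reachable_sym (G : simple_graph) (x y : G) :
  reachable x y -> reachable y x.
Proof.
elim=> [u v uv|u|u v w _ vu _ wv]; first by apply: rt_step; exact: adj_sym.
  exact: rt_refl.
exact: rt_trans wv vu.
Qed.

Lemma reachable_embedding (G H : simple_graph) (f : G -> H) (x y : G) :
  embedding f -> reachable x y -> reachable (f x) (f y).
Proof.
move=> [_ fadj]; elim=> [u v uv|u|u v w _ uv _ vw].
- by apply: rt_step; exact: fadj.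
- exact: rt_refl.
- exact: rt_trans uv vw.
Qed.

Lemma acyclic_embedding (G H : simple_graph) (f : G -> H) :
  embedding f -> acyclic H -> acyclic G.
Proof.
move=> [f_inj fadj] acH n c [n3 c_inj cadj]; apply: (acH n (f \o c)).
by split => // [|i]; [exact: inj_comp | exact: fadj].
Qed.

Lemma embedding_sval (G : simple_graph) (A : set G) :
  embedding (fun v : induced G A => sval v).
Proof. by split => //; exact: sval_inj. Qed.

Lemma embedding_comp (G H K : simple_graph) (f : H -> K) (g : G -> H) :
  embedding f -> embedding g -> embedding (f \o g).
Proof.
move=> [fi fa] [gi ga]; split; first exact: inj_comp.
by move=> x y xy; apply: fa; exact: ga.
Qed.

(** * Balls under isomorphisms *)

Lemma sval_ball (G : simple_graph) (A : set G) (o : induced G A) (n : nat) :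
  sval @` ball (induced G A) setT o n = ball G A (sval o) n.
Proof.
elim: n => [|n IH] /=; first by rewrite image_set1.
rewrite image_setU IH; congr (_ `|` _); apply/seteqP; split => z /=.
  move=> [w [_ [y hy yw]] <-]; split; first exact: vin_prop.
  by exists (sval y) => //; rewrite -IH; exists y.
move=> [Az [y]]; rewrite -IH => -[w hw <-] wz.
by exists (vin z Az) => //; split => //; exists w.
Qed.

Lemma iso_ball (G H : simple_graph) (f : G -> H) (o : G) (n : nat) :
  bijective f -> (forall x y, adj x y <-> adj (f x) (f y)) ->
  f @` ball G setT o n = ball H setT (f o) n.
Proof.
move=> [g fK gK] fadj; elim: n => [|n IH] /=; first by rewrite image_set1.
rewrite image_setU IH; congr (_ `|` _); apply/seteqP; split => z /=.
  move=> [w [_ [y hy yw]] <-]; split => //.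
  by exists (f y); [rewrite -IH; exists y | apply/fadj].
move=> [_ [y]]; rewrite -IH => -[w hw <-] wz.
exists (g z) => //; split => //; exists w => //.
by apply/fadj; rewrite gK.
Qed.

(** The injective maps [sval] and [f] carry balls to balls. Both sides are balls of the ambient [G],
    which makes different induced subgraphs comparable. *)
Lemma iso_ball_card (G : simple_graph) (A B : set G)
    (f : induced G A -> induced G B) (o : induced G A) (n : nat) :
  bijective f -> (forall x y, adj x y <-> adj (f x) (f y)) ->
  (ball G A (sval o) n #= ball G B (sval (f o)) n)%card.
Proof.
move=> fbij fadj; rewrite -!sval_ball -(iso_ball _ _ f) //.
have cimg (U V : Type) (h : U -> V) (X : set U) :
    injective h -> (h @` X #= X)%card.
  by move=> hinj; apply: inj_card_eq => x y _ _; exact: hinj.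
apply: card_eq_trans (cimg _ _ _ _ (@sval_inj _ _)) _.
rewrite card_eq_sym.
apply: card_eq_trans (cimg _ _ _ _ (@sval_inj _ _)) _.
exact: cimg (bij_inj fbij).
Qed.

Lemma isomorphic_refl (G : simple_graph) : isomorphic G G.
Proof. by exists id => //; exists id. Qed.

(** * The boundary of a vertex set *)

Definition boundary (G : simple_graph) (A : set G) : set G :=
  [set c | ~ A c /\ exists2 y, A y & adj y c].

(** Every component left after deleting [A] contains a boundary vertex, so the components lie in the
    image of the boundary under [h]. *)
Lemma infinite_boundary (G : simple_graph) (A : set G) :
  connected_graph G -> A !=set0 ->
  infinite_set (components (delete_vertices A)) ->
  infinite_set (boundary G A).
Proof.
move=> [_ conG] [a Aa] infC finB; apply: infC.
pose h (c : G) : set (delete_vertices A) :=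
  [set y | exists nAc : ~ A c, @reachable (delete_vertices A) (exist _ c nAc) y].
apply: sub_finite_set (finite_image h finB) => _ [x _ <-].
(* On a walk from [a] to [z], the vertex [c] is the one right after the last visit to [A]. *)
have key n : forall z : delete_vertices A, ball G setT a n (sval z) ->
    exists2 c, boundary G A c & h c z.
  elim: n => [|n IH] [z nAz] /=; first by move=> za; case: nAz; rewrite za.
  move=> [|[_ [y hy yz]]]; first exact: (IH (exist _ z nAz)).
  have [Ay|nAy] := pselect (A y).
    exists z; first by split => //; exists y.
    by exists nAz; exact: rt_refl.
  have [c bc [nAc cy]] := IH (exist _ y nAy) hy.
  by exists c => //; exists nAc; apply: rt_trans cy _; exact: rt_step.
have [n hn] := reachable_ball _ _ _ (conG a (sval x)).
have [c bc [nAc cx]] := key n x hn.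
exists c => //; apply/seteqP; split => y /=.
  by move=> [nAc' cy]; apply: rt_trans (reachable_sym _ _ _ cx) _;
     rewrite (Prop_irrelevance nAc nAc').
by move=> xy; exists nAc; exact: rt_trans cx xy.
Qed.

(** * Ball sizes and attached boundary vertices *)

(** At a first index [i] in [I] but not in [J], the ball of radius [r i.+1] for [J] lies in the one
    for [I] and misses [c i], so the finite sizes differ. *)
Lemma ball_attach_inj (G : simple_graph) (A : set G) (o : G)
    (c : nat -> G) (r : nat -> nat) :
  locally_finite G -> A o -> (forall i, ~ A (c i)) ->
  (forall i, ~ ball G setT o (r i) (c i)) ->
  (forall i, ball G (A `|` [set c i]) o (r i.+1) (c i)) ->
  forall I J : set nat,
    (forall n, (ball G (A `|` c @` I) o n #= ball G (A `|` c @` J) o n)%card) ->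
    I = J.
Proof.
move=> lf Ao nAc far near.
have nearT i : ball G setT o (r i.+1) (c i) by exact: ball_mono (near i).
have rS i : r i <= r i.+1.
  by rewrite leqNgt; apply/negP => /ltnW ri; apply: (far i); exact: ball_leq (nearT i).
have r_mono : {homo r : i j / i <= j}.
  by apply: homo_leq => // i j k; exact: leq_trans.
have step (I J : set nat) i :
    (forall n, (ball G (A `|` c @` I) o n #= ball G (A `|` c @` J) o n)%card) ->
    (forall j, j < i -> J j -> I j) -> I i -> J i.
  move=> cIJ agree Ii; apply: contrapT => nJi.
  (* Below [i] the indices of [J] are in [I]; above [i] the vertices [c j] are out of reach at this
     radius. *)
  have JI : ball G (A `|` c @` J) o (r i.+1) `<=` ball G (A `|` c @` I) o (r i.+1).
    apply: ball_local => z [[Az|[j Jj <-]] bz]; [by left|right].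
    case: (ltngtP j i) => [ji|ij|ji]; last by case: nJi; rewrite -ji.
      by exists j => //; exact: agree.
    by case: (far j); apply: ball_leq bz; exact: r_mono.
  have finI := finite_ball G (A `|` c @` I) o (r i.+1) lf.
  have : ball G (A `|` c @` J) o (r i.+1) (c i).
    rewrite (finite_subset_card_eq _ _ _ finI JI); last by rewrite card_eq_sym.
    by apply: ball_mono (near i) => z [|->]; [left|right; exists i].
  (* Here [c i] is some [c j] with [j] in [J]; the radii separate distinct indices, so [j] would be
     [i]. *)
  move=> /(ball_sub _ _ _ _ (or_introl Ao)) [/nAc//|[j Jj cji]].
  case: (ltngtP j i) => [ji|ij|ji]; last by case: nJi; rewrite -ji.
    by case: (far i); rewrite -cji; apply: ball_leq (nearT j); exact: r_mono.
  by case: (far j); rewrite cji; apply: ball_leq (nearT i); exact: r_mono.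
move=> I J cIJ.
have cJI n : (ball G (A `|` c @` J) o n #= ball G (A `|` c @` I) o n)%card.
  by rewrite card_eq_sym.
suff IJ i : I i <-> J i by apply/seteqP; split => i /IJ.
elim/ltn_ind: i => i IH.
by split; apply: step => // j /IH [].
Qed.

(** Greedy choice: balls are finite, so some boundary vertex [c i] avoids the ball of radius [r i];
    connectedness of the graph induced on [A] then gives a radius [r i.+1] that reaches it. *)
Lemma sparse_boundary (G : simple_graph) (A : set G) (o : G) (Ao : A o) :
  locally_finite G -> connected_graph (induced G A) ->
  infinite_set (boundary G A) ->
  exists (c : nat -> G) (r : nat -> nat),
    [/\ forall i, boundary G A (c i),
        forall i, ~ ball G setT o (r i) (c i) &
        forall i, ball G (A `|` [set c i]) o (r i.+1) (c i)].
Proof.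
move=> lf [_ conA] infB.
have next n : exists c, boundary G A c /\ ~ ball G setT o n c.
  by have /infinite_setN0 [c] := infinite_setD infB (finite_ball G setT o n lf); exists c.
have rad c : exists n, boundary G A c -> ball G (A `|` [set c]) o n c.
  have [[nAc [y Ay yc]]|nb] := pselect (boundary G A c); last by exists 0.
  have [n hn] := reachable_ball _ _ _ (conA (vin o Ao) (vin y Ay)).
  exists n.+1 => _; right; split; first by right.
  exists y => //; have : ball G A o n y by rewrite -(sval_ball _ _ (vin o Ao)); exists (vin y Ay).
  by apply: ball_mono => z; left.
have [f fP] := choice next; have [g gP] := choice rad.
pose r := fix r i := if i is j.+1 then g (f (r j)) else 0.
exists (f \o r), r; split => i; [exact: (fP _).1|exact: (fP _).2|].
by apply: gP; exact: (fP _).1.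
Qed.

Lemma countable_graph (G : simple_graph) :
  locally_finite G -> connected_graph G -> countable [set: G].
Proof.
move=> lf [[o] con].
have -> : [set: G] = \bigcup_n ball G setT o n.
  by apply/seteqP; split => // x _; have [n] := reachable_ball _ _ _ (con o x); exists n.
apply: bigcup_countable => // n _.
by apply: finite_set_countable; exact: finite_ball.
Qed.

(** * Twins between the image and its boundary, and their classes *)

(** Each added vertex is adjacent to the connected image of [phi]. [T] embeds through [S] into that
    image. *)
Lemma extended_image_twin (S T : simple_graph) (phi : S -> T) (A : set T) :
  is_tree T -> is_tree S -> embedding phi -> embeds T S ->
  range phi `<=` A -> A `<=` range phi `|` boundary T (range phi) ->
  is_tree (induced T A) /\ equimorphic (induced T A) T.
Proof.
move=> [_ acT] [[[s] conS] _] ephi [psi epsi] phiA Abd.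
pose f (x : S) : induced T A := vin (phi x) (phiA _ (imageT phi x)).
have ef : embedding f.
  case: ephi => phi_inj phi_adj; split => [x y fxy|//].
  by apply: phi_inj; exact: (congr1 (fun v : induced T A => sval v) fxy).
split; last first.
  split; first by exists (fun v => sval v); exact: embedding_sval.
  by exists (f \o psi); exact: embedding_comp.
split; last exact: acyclic_embedding (embedding_sval _ _) acT.
split; first by exists; exact: f s.
suff fromf x : reachable (f s) x.
  by move=> x y; apply: rt_trans (fromf y); exact: reachable_sym.
have reach_range t : reachable (f s) (f t) by exact: reachable_embedding.
have [[t _ tx]|[_ [_ [t _ <-] tx]]] := Abd _ (vin_prop _ _ x).
  by have -> : x = f t by apply: sval_inj.
by apply: rt_trans (reach_range t) _; exact: rt_step.
Qed.

Theorem theorem2 (T S : simple_graph) (hT : is_tree T)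
    (hlf : locally_finite T) (hS : is_tree S) (hST : equimorphic S T)
    (hphi : exists phi : S -> T, embedding phi /\
      infinite_set (components (delete_vertices (range phi)))) :
  infinite_set (twin_classes T).
Proof.
move=> fin_cl.
case: hphi => phi [ephi infC]; case: hST => _ TS.
have [[[s] _] _] := hS; pose A := range phi.
have Ao : A (phi s) by exists s.
have [conA _] : is_tree (induced T A) /\ equimorphic (induced T A) T.
  by apply: (extended_image_twin S T phi) => // x; left.
have infB : infinite_set (boundary T A).
  by apply: infinite_boundary => //; [exact: hT.1 | exists (phi s)].
have [c [r [cB far near]]] := sparse_boundary _ _ _ Ao hlf conA.1 infB.
pose X (I : set nat) := A `|` c @` I.
pose o I : induced T (X I) := vin (phi s) (or_introl Ao).
pose cls I := iso_class (induced T (X I)).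
have cls_twin I : twin_classes T (cls I).
  exists (induced T (X I)) => //; apply: (extended_image_twin S T phi) => //.
    by move=> x; left.
  by move=> x [|[i _ <-]]; [left|right].
(* [rep] picks one index set per class; [set0] is a dummy value off the range of [cls]. *)
have /choice [rep repP] : forall C, exists J, (exists I, cls I = C) -> cls J = C.
  move=> C; have [[I IC]|nC] := pselect (exists I, cls I = C); first by exists I.
  by exists set0.
(* [x I] is the image of the root under an isomorphism onto the representative of the class of
   [I]. *)
have /choice [x xP] : forall I, exists x : T, forall n,
    (ball T (X I) (phi s) n #= ball T (X (rep (cls I))) x n)%card.
  move=> I; have eqc : cls (rep (cls I)) = cls I by apply: repP; exists I.
  have [f fbij fadj] : isomorphic (induced T (X I)) (induced T (X (rep (cls I)))).
    (* The representative belongs to its own class, which equals [cls I]. *)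
    suff : cls I (induced T (X (rep (cls I)))) by [].
    by rewrite -{1}eqc; exact: isomorphic_refl.
  by exists (sval (f (o I))) => n; exact: (iso_ball_card _ _ _ f (o I)).
have /countable_injP [k k_inj] := finite_set_countable fin_cl.
have /countable_injP [e e_inj] := countable_graph _ hlf hT.1.
(* The class and the vertex [x I] together fix all ball sizes at the root, hence [I]; both range
   over countable sets, so the pair has a natural number as code. *)
apply: (not_injective_set_nat (fun I => choice.pickle (k (cls I), e (x I)))) => I J.
move=> /(pcan_inj choice.pickleK) [/k_inj eq_cls /e_inj eq_x].
have {}eq_cls : cls I = cls J by apply: eq_cls; apply/mem_set.
have {}eq_x : x I = x J by apply: eq_x; apply/mem_set.
apply: (ball_attach_inj _ _ _ _ _ hlf Ao _ far near) => [i|n].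
  exact: (cB i).1.
apply: card_eq_trans (xP I n) _; rewrite card_eq_sym.
by rewrite eq_cls eq_x; exact: xP.
Qed.
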